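(* Let $1 \le p < \infty$. Then $JN_{p,p}(\mathbb{R}^n) = L^p(\mathbb{R}^n)/\mathbb{R}$, and there is a constant $c = c(p)$ depending only on $p$ such that for any function $f \in L^1_{loc}(\mathbb{R}^n)$ we have $$\frac{1}{c}\,\|f\|_{JN_{p,p}(\mathbb{R}^n)} \le \inf_{b\in\mathbb{R}} \|f-b\|_{L^p(\mathbb{R}^n)} \le c\,\|f\|_{JN_{p,p}(\mathbb{R}^n)} .$$
   Context: A cube means an open (bounded) cube in $\mathbb{R}^n$ with edges parallel to the coordinate axes. For measurable $E$ with $0<|E|<\infty$ write $f_E = \frac{1}{|E|}\int_E f$, also denoted $⨍$-average (integral average) of $f$ over $E$. For $1\le p<\infty$ and $1\le q<\infty$, a function $f$ is in $JN_{p,q}(\mathbb{R}^n)$ if $f\in L^1_{loc}(\mathbb{R}^n)$ and there is a constant $K<\infty$ such that $$\sum_{i=1}^\infty |Q_i|\left(\frac{1}{|Q_i|}\int_{Q_i}|f-f_{Q_i}|^q\right)^{p/q}\le K^p$$ for all countable collections of pairwise disjoint cubes $(Q_i)_{i=1}^\infty$ in $\mathbb{R}^n$; the smallest such $K$ is denoted $\|f\|_{JN_{p,q}(\mathbb{R}^n)}$ (understood as $\infty$ if no such $K$ exists). $L^p(\mathbb{R}^n)/\mathbb{R}$ denotes the space of functions $f$ for which there is a constant $b\in\mathbb{R}$ such that $f-b\in L^p(\mathbb{R}^n)$; $\|f-b\|_{L^p}$ is understood as $\infty$ if $f-b\notin L^p$. *)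

(* Defs.v *)
(* Points of R^n.+1 (a positive dimension) are row vectors. *)
From HB Require Import structures.
From mathcomp Require Import all_boot all_order all_algebra.
From mathcomp Require Import all_classical all_reals all_analysis.

Set Implicit Arguments.
Unset Strict Implicit.
Unset Printing Implicit Defensive.
Import Order.TTheory GRing.Theory Num.Theory.
Import numFieldNormedType.Exports.
Local Open Scope classical_set_scope.
Local Open Scope ring_scope.

Section lebesgue_measure_Rn.
Context {R : realType} (n : nat).
Implicit Types a b : 'rV[R]_n.+1.

Definition open_box a b : set 'rV[R]_n.+1 :=
  [set x | forall i, a ord0 i < x ord0 i < b ord0 i].

Definition box_volume a b : R :=
  \prod_(i < n.+1) Num.max 0 (b ord0 i - a ord0 i).

(* Sequences of pairs of opposite corners whose open boxes cover A.  Boxes may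
   be empty (volume 0), so finite covers are included. *)
Definition box_cover (A : set 'rV[R]_n.+1)
    : set (nat -> 'rV[R]_n.+1 * 'rV[R]_n.+1) :=
  [set F | A `<=` \bigcup_k open_box (F k).1 (F k).2].

Definition lebesgue_outer (A : set 'rV[R]_n.+1) : \bar R :=
  ereal_inf [set (\sum_(k <oo) (box_volume (F k).1 (F k).2)%:E)%E
            | F in box_cover A].

Local Open Scope ereal_scope.

Lemma box_volume_ge0 a b : 0 <= (box_volume a b)%:E.
Proof. by rewrite lee_fin prodr_ge0// => i _; rewrite le_max lexx. Qed.

Lemma lebesgue_outer_ge0 A : 0 <= lebesgue_outer A.
Proof.
apply: le_ereal_inf_tmp => _ [F _ <-].
by apply: nneseries_ge0 => k _ _; exact: box_volume_ge0.
Qed.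

Lemma lebesgue_outer0 : lebesgue_outer set0 = 0.
Proof.
apply/eqP; rewrite eq_le lebesgue_outer_ge0 andbT.
apply: ereal_inf_lbound; exists (fun=> (0%R, 0%R)); first exact: sub0set.
by rewrite eseries0// => k _ _;
  rewrite /box_volume /= big_ord_recl !mxE subrr maxxx mul0r.
Qed.

Lemma le_lebesgue_outer :
  {homo lebesgue_outer : A B / A `<=` B >-> A <= B}.
Proof.
move=> A B AB; apply/ereal_inf_le_tmp => _ [F BF <-].
by exists F => //; exact: subset_trans AB BF.
Qed.

Lemma lebesgue_outer_sigma_subadditive : sigma_subadditive lebesgue_outer.
Proof.
move=> A; have [[i ioo]|] := pselect (exists i, lebesgue_outer (A i) = +oo).
  rewrite (eseries_pinfty _ _ ioo) ?leey// => k _.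
  by rewrite -ltNye (lt_le_trans _ (lebesgue_outer_ge0 _)).
rewrite -forallNE => Aoo.
suff add2e (e : {posnum R}) : lebesgue_outer (\bigcup_k A k) <=
    \sum_(i <oo) lebesgue_outer (A i) + e%:num%:E.
  by apply/lee_addgt0Pr => _/posnumP[].
rewrite (le_trans _ (epsilon_trick _ _ _))//; last first.
  by move=> k; exact: lebesgue_outer_ge0.
pose v (F : 'rV[R]_n.+1 * 'rV[R]_n.+1) := (box_volume F.1 F.2)%:E.
have v0 F : 0 <= v F by exact: box_volume_ge0.
pose P k F := box_cover (A k) F /\
  \sum_(j <oo) v (F j) <= lebesgue_outer (A k) + (e%:num / (2 ^ k.+1)%:R)%:E.
have [G PG] : {G : nat -> nat -> 'rV[R]_n.+1 * 'rV[R]_n.+1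
              & forall k, P k (G k)}.
  apply: (@choice _ _ P) => k; rewrite /P /lebesgue_outer.
  set S := (X in ereal_inf X); move infS : (ereal_inf S) => iS.
  case: iS infS => [r Sr|Soo|Soo].
  - have en1 : (0 < e%:num / (2 ^ k.+1)%:R)%R by [].
    have /(lb_ereal_inf_adherent en1) : ereal_inf S \is a fin_num by rewrite Sr.
    move=> [_ [F AF <-] ltF].
    by exists F; split => //; rewrite -Sr; exact/ltW.
  - by have := Aoo k; rewrite /lebesgue_outer -/S Soo.
  - suff : lbound S 0 by move/le_ereal_inf_tmp; rewrite Soo.
    by move=> /= _ [F AF <-]; apply: nneseries_ge0 => j _ _; exact: (v0 (F j)).
have vG_ge0 x : 0 <= (v \o uncurry G) x by exact: v0.
apply: (@le_trans _ _ (\esum_(i in setT) (v \o uncurry G) i)).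
  apply: ereal_inf_lbound => /=.
  have /card_esym/ppcard_eqP[f] := card_nat2.
  exists (uncurry G \o f).
    move=> t [i _ /(PG i).1[j _ Gijt]].
    by exists (f^-1%FUN (i, j)) => //=; rewrite invK ?inE.
  rewrite -(esum_pred_image (v \o uncurry G) _ xpredT) ?[fun=> _]set_true//.
  by rewrite image_eq.
rewrite (_ : esum _ _ = \sum_(i <oo) \sum_(j <oo) v (G i j)); last first.
  pose J : nat -> set (nat * nat) := fun i => [set (i, j) | j in setT].
  rewrite (_ : setT = \bigcup_k J k); last first.
    by rewrite predeqE => -[a b]; split => // _; exists a => //; exists b.
  rewrite esum_bigcupT /=; last 2 first.
    - apply/trivIsetP => i j _ _ ij.
      rewrite predeqE => -[k m] /=; split => //= -[] [_] _ [<-{k} _].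
      by move=> [m' _] [] /esym/eqP; rewrite (negbTE ij).
    - by move=> /= [k m]; exact: v0.
  rewrite -(image_id [set: nat]) -fun_true esum_pred_image//; last first.
    by move=> k _; exact: esum_ge0.
  apply: eq_eseriesr => /= j _.
  rewrite -(esum_pred_image (v \o uncurry G) (pair j) predT)//=; last first.
    by move=> ? ? _ _; exact: (@can_inj _ _ _ snd).
  by congr esum; rewrite predeqE => -[a b]; split; move=> [i _ <-]; exists i.
apply: lee_lim.
- apply: is_cvg_nneseries => k *.
  by apply: nneseries_ge0 => m *; exact: (vG_ge0 (k, m)).
- by apply: is_cvg_nneseries => k *; apply: adde_ge0 => //;
    exact: lebesgue_outer_ge0.
- by near=> k; apply: lee_sum => i _; exact: (PG i).2.
Unshelve. all: by end_near. Qed.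

HB.instance Definition _ := isOuterMeasure.Build R 'rV[R]_n.+1 lebesgue_outer
  lebesgue_outer0 lebesgue_outer_ge0 le_lebesgue_outer
  lebesgue_outer_sigma_subadditive.

End lebesgue_measure_Rn.

Arguments lebesgue_outer R n A : clear implicits.

(* R^n.+1 with the (complete) sigma-algebra of Lebesgue measurable sets, and
   Lebesgue measure on it; the underlying type is 'rV[R]_n.+1. *)
Notation Rn R n := (caratheodory_type (lebesgue_outer R n)).

Definition lebesgue (R : realType) (n : nat) : set (Rn R n) -> \bar R :=
  lebesgue_outer R n.

Arguments lebesgue R n A : clear implicits.

HB.instance Definition _ (R : realType) (n : nat) :=
  isMeasure.Build _ _ _ (lebesgue R n)
    (@caratheodory_measure0 _ _ (lebesgue_outer R n))
    (@caratheodory_measure_ge0 _ _ (lebesgue_outer R n))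
    (@caratheodory_measure_sigma_additive _ _ (lebesgue_outer R n)).


Definition locally_integrableRn (R : realType) (n : nat) (f : Rn R n -> R) :=
  measurable_fun [set: Rn R n] f /\
  forall K : set 'rV[R]_n.+1, compact K ->
    (\int[lebesgue R n]_(x in K) `|f x|%:E < +oo)%E.

Definition is_cube (R : realType) (n : nat) (Q : set (Rn R n)) :=
  exists (a : 'rV[R]_n.+1) (l : R),
    0 < l /\ Q = open_box a (a + const_mx l).

Section JN.
Context {R : realType} {n : nat}.
Local Notation mu := (lebesgue R n).
Implicit Types (f : Rn R n -> R) (E : set (Rn R n)).

Definition average f E : R :=
  (fine (mu E))^-1 * \int[mu]_(x in E) f x.

(* The average of |f - f_E|^q over E, which may be +oo. *)
Definition mean_oscillation (q : R) f E : \bar R :=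
  ((fine (mu E))^-1%:E *
   \int[mu]_(x in E) (`|f x - average f E| `^ q)%:E)%E.

Definition JN_bound (p q : R) f (K : R) :=
  forall Q : nat -> set (Rn R n),
    (forall i, is_cube (Q i)) -> trivIset [set: nat] Q ->
    (\sum_(i <oo) (mu (Q i) * mean_oscillation q f (Q i) `^ (p / q))
      <= (K `^ p)%:E)%E.

(* The infimum of the empty set is +oo. *)
Definition JN_norm (p q : R) f : \bar R :=
  ereal_inf [set K%:E | K in [set K | 0 <= K /\ JN_bound p q f K]].

End JN.

Definition JN (R : realType) (n : nat) (p q : R) : set (Rn R n -> R) :=
  [set f | locally_integrableRn f /\ exists2 K, 0 <= K & JN_bound p q f K].

Definition Lp_mod_cst (R : realType) (n : nat) (p : R) : set (Rn R n -> R) :=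
  [set f | exists b : R, (fun x => f x - b) \in Lfun (lebesgue R n) p%:E].

Arguments JN R n p q : clear implicits.
Arguments Lp_mod_cst R n p : clear implicits.

(* Main.v *)
Require Import Defs.
From HB Require Import structures.
From mathcomp Require Import all_boot all_order all_algebra.
From mathcomp Require Import all_classical all_reals all_analysis.
From mathcomp Require Import measurable_realfun.
From mathcomp Require Import ring lra.

(** Both inequalities hold with the constant 2.  Since p = q, the term of a cube
Q in the sum defining the bound is just the integral of |f - f_Q|^p over Q.  Let
V be the measure of Q.

If f - b is in L^p, then by Jensen's inequality |f_Q - b|^p V is at most the
integral of |f - b|^p over Q ([powR_mean_dist_le]).  Hence replacing b by the
average f_Q costs at most a factor 2^p ([integral_oscillation_le]), and summing
over disjoint cubes gives the bound K = 2 ||f - b||_p ([JN_bound_of_Lp]).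

Conversely, let K be a bound, and let C_0, C_1, ... be the centered cubes, which
increase to the whole space.  On each C_k the integral of |f - c_k|^p is at most
K^p, where c_k is the average of f over C_k.  Jensen's inequality on C_0 shows
that |c_0 - c_k|^p is at most K^p / |C_0|, so the sequence c is bounded and has a
limit point b.  Fatou's lemma along a subsequence yields ||f - b||_p <= K
([JN_bound_Lp]).

All this uses very little of Lebesgue measure: cubes are measurable, and their
measure is positive and finite ([cube_measure]).  Finiteness is immediate from
the definition as an outer measure.  For positivity one has to see that
countably many boxes covering a box have at least its total volume; this follows
by integrating the inequality between indicator functions one variable at a
time against the measure of the line ([prod_indic_le_volume]).  Measurability
comes from half-spaces: a box cut by a hyperplane is contained in two boxes
whose total volume exceeds that of the box by as little as one wishes
([box_volume_split]). *)

Set Implicit Arguments.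
Unset Strict Implicit.
Unset Printing Implicit Defensive.
Import Order.TTheory GRing.Theory Num.Theory.
Import numFieldNormedType.Exports.
Local Open Scope classical_set_scope.
Local Open Scope ring_scope.

(** * Volumes of boxes covering a box *)

Section volume.
Context {R : realType}.

Lemma lebesgue_measure_oo (a b : R) :
  lebesgue_measure `]a, b[%classic = (Num.max 0 (b - a))%:E.
Proof.
rewrite lebesgue_measure_itv /= lte_fin; case: ltP => ab.
  by rewrite -EFinD max_r// subr_ge0 ltW.
by rewrite max_l// subr_le0.
Qed.

Lemma integral_indic_oo (c a b : R) : 0 <= c ->
  (\int[lebesgue_measure]_t (c * \1_(`]a, b[) t)%:E =
   (c * Num.max 0 (b - a))%:E)%E.
Proof.
move=> c0; under eq_integral do rewrite EFinM.
rewrite ge0_integralZl_EFin//; first last.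
  exact/measurable_EFinP.
rewrite integral_indic// setIT EFinM; congr (_ * _)%E.
exact: lebesgue_measure_oo.
Qed.

(** Integrating the hypothesis in the last variable, with the other ones fixed,
turns it into the same hypothesis in one variable less: the factor depending on
the last variable becomes a length, which is absorbed into the coefficients [c]
and [C k].  Monotone convergence exchanges the integral and the series, and takes
the place of the usual compactness argument.  Sequences stand for points so that the
number of variables can vary in the induction. *)
Lemma prod_indic_le_volume n (c : R) (C : nat -> R) (a b : nat -> R)
    (A B : nat -> nat -> R) :
  0 <= c -> (forall k, 0 <= C k) ->
  (forall x : nat -> R,
    (c * \prod_(i < n) \1_(`]a i, b i[) (x i))%:E <=
    \sum_(k <oo) (C k * \prod_(i < n) \1_(`]A k i, B k i[) (x i))%:E)%E ->
  ((c * \prod_(i < n) Num.max 0 (b i - a i))%:E <=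
   \sum_(k <oo) (C k * \prod_(i < n) Num.max 0 (B k i - A k i))%:E)%E.
Proof.
have prod1 m (u v x : nat -> R) : 0 <= \prod_(i < m) \1_(`]u i, v i[) (x i).
  exact: prodr_ge0.
elim: n c C => [|n IH] c C c0 C0 cC.
  have := cC (fun=> 0); rewrite !big_ord0.
  under eq_eseriesr do rewrite big_ord0.
  by under [in X in _ -> X]eq_eseriesr do rewrite big_ord0.
have volS (r : R) (u v : nat -> R) :
    r * \prod_(i < n.+1) Num.max 0 (v i - u i) =
    r * Num.max 0 (v n - u n) * \prod_(i < n) Num.max 0 (v i - u i).
  by rewrite big_ord_recr/= mulrA mulrAC.
rewrite volS; under eq_eseriesr do rewrite volS.
apply: IH.
- by rewrite mulr_ge0// le_max lexx.
- by move=> k; rewrite mulr_ge0// le_max lexx.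
move=> x.
rewrite mulrAC -integral_indic_oo; last by rewrite mulr_ge0.
under eq_eseriesr do (rewrite mulrAC -integral_indic_oo; last by rewrite mulr_ge0).
have mC (k : R) (u v : R) : measurable_fun setT (fun t : R => (k * \1_(`]u, v[) t)%:E).
  by apply/measurable_EFinP; exact: measurable_funM.
rewrite -integral_nneseries//; last 2 first.
- by move=> k; exact: mC.
- by move=> k t _; rewrite lee_fin mulr_ge0// mulr_ge0.
apply: ge0_le_integral => //.
- by move=> t _; rewrite lee_fin mulr_ge0// mulr_ge0.
- exact: mC.
- apply: ge0_emeasurable_sum => // k; last by move=> _; exact: mC.
  by move=> t _ _; rewrite lee_fin mulr_ge0// mulr_ge0.
move=> t _; have := cC (fun i => if i == n then t else x i).
rewrite big_ord_recr/= eqxx mulrA.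
rewrite (eq_bigr (fun i : 'I_n => \1_(`]a i, b i[) (x i))); last first.
  by move=> i _; rewrite ltn_eqF.
move=> /le_trans; apply; rewrite le_eqVlt; apply/orP; left; apply/eqP.
apply: eq_eseriesr => k _; rewrite big_ord_recr/= eqxx mulrA.
by congr (_ * _ * _)%:E; apply: eq_bigr => i _; rewrite ltn_eqF.
Qed.

End volume.

(** * Boxes are measurable and their measure is their volume *)

Section boxes.
Context {R : realType} {n : nat}.
Implicit Types a b : 'rV[R]_n.+1.

Lemma indic_open_box a b (x : 'rV[R]_n.+1) :
  \1_(open_box a b) x =
  \prod_(i < n.+1) \1_(`]a ord0 i, b ord0 i[) (x ord0 i) :> R.
Proof.
rewrite indicE; case: (boolP (x \in open_box a b)) => [|/negP xab].
  rewrite inE => xab; rewrite big1// => i _; rewrite indicE mem_set//=.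
  by rewrite in_itv/= xab.
have /existsNP[i xi] : ~ (forall i, a ord0 i < x ord0 i < b ord0 i).
  by move=> H; apply: xab; rewrite inE.
by rewrite (bigD1 i)//= [X in X * _]indicE memNset ?mul0r.
Qed.

Lemma lebesgue_outer_open_box a b :
  lebesgue_outer R n (open_box a b) = (box_volume a b)%:E.
Proof.
apply/eqP; rewrite eq_le; apply/andP; split.
  apply: ereal_inf_lbound; exists (fun k => if k == 0%N then (a, b) else (0, 0)).
    by move=> x xab; exists 0%N.
  rewrite (nneseriesD1 (n := 0%N))//=; last first.
    by move=> k _; exact: box_volume_ge0.
  rewrite eseries0 ?adde0// => k _ /negPf ->.
  by rewrite /box_volume /= big_ord_recl !mxE subrr maxxx mul0r.
apply: le_ereal_inf_tmp => _ [F abF <-].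
have dom := @prod_indic_le_volume R n.+1 1 (fun=> 1)
  (fun i => a ord0 (inord i)) (fun i => b ord0 (inord i))
  (fun k i => (F k).1 ord0 (inord i)) (fun k i => (F k).2 ord0 (inord i))
  ler01 (fun=> ler01).
have volE (c d : 'rV[R]_n.+1) : 1 * \prod_(i < n.+1)
    Num.max 0 (d ord0 (inord i) - c ord0 (inord i)) = box_volume c d.
  by rewrite mul1r; apply: eq_bigr => i _; rewrite inord_val.
rewrite -volE; under eq_eseriesr do rewrite -volE.
apply: dom => x; pose y : 'rV[R]_n.+1 := \row_i x i.
have indE (c d : 'rV[R]_n.+1) : 1 * \prod_(i < n.+1)
    \1_(`]c ord0 (inord i), d ord0 (inord i)[) (x i) = \1_(open_box c d) y :> R.
  by rewrite mul1r indic_open_box; apply: eq_bigr => i _; rewrite inord_val mxE.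
rewrite indE; under eq_eseriesr do rewrite indE.
rewrite [in leLHS]indicE; case: (boolP (y \in _)) => [|_]; last first.
  by apply: nneseries_ge0 => k _ _; rewrite lee_fin.
rewrite inE => /abF[k _ yk].
rewrite (nneseriesD1 (n := k))//= ?indicE ?mem_set//=.
by rewrite leeDl//; apply: nneseries_ge0 => j _ _; rewrite lee_fin.
Qed.

Definition set_coord (x : 'rV[R]_n.+1) (i : 'I_n.+1) (t : R) : 'rV[R]_n.+1 :=
  \row_j (if j == i then t else x ord0 j).

(** The first box contains the part of the open box where the [i]-th coordinate
is greater than [c].  The rest of the open box is not open, which is why the
second box has to reach slightly beyond the hyperplane, up to [c + d]. *)
Lemma box_volume_split a b i (c e : R) : 0 < e ->
  exists d : R, 0 < d /\
   (box_volume (set_coord a i (Num.max (a ord0 i) c)) b +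
    box_volume a (set_coord b i (Num.min (b ord0 i) (c + d))) <=
    box_volume a b + e).
Proof.
move=> e0.
pose W := \prod_(j < n.+1 | j != i) Num.max 0 (b ord0 j - a ord0 j).
have W0 : 0 <= W by apply: prodr_ge0 => j _; rewrite le_max lexx.
(* the overlap of the two boxes has volume at most d * W; adding 1 avoids
   dividing by 0 when W = 0 *)
exists (e / (1 + W)); split; first by rewrite divr_gt0// ltr_pwDl.
have volE (u v : 'rV[R]_n.+1) : box_volume u v = Num.max 0 (v ord0 i - u ord0 i) *
    \prod_(j < n.+1 | j != i) Num.max 0 (v ord0 j - u ord0 j).
  by rewrite /box_volume (bigD1 i).
rewrite !volE -/W.
under [X in _ * X + _ <= _]eq_bigr => j /negPf ji do rewrite mxE ji.
under [X in _ + _ * X <= _]eq_bigr => j /negPf ji do rewrite mxE ji.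
rewrite -/W !mxE eqxx -mulrDl.
set d := e / (1 + W).
have d0 : 0 < d by rewrite divr_gt0// ltr_pwDl.
have dW : d * W <= e.
  by rewrite /d mulrAC ler_pdivrMr ?ltr_pwDl// ler_pM2l// lerDr.
apply: (@le_trans _ _ ((Num.max 0 (b ord0 i - a ord0 i) + d) * W)).
  rewrite ler_wpM2r//.
  rewrite /Num.max /Num.min; do ![case: ifPn]; rewrite -?leNgt; lra.
by rewrite mulrDl lerD2l.
Qed.

(** In Caratheodory's criterion, a cover of [X] is split into covers of both
parts of [X]; the error made on the [k]-th box is [e / 2 ^ k.+1]. *)
Lemma measurable_coord_gt (i : 'I_n.+1) (c : R) :
  measurable [set x : Rn R n | c < x ord0 i].
Proof.
apply: le_caratheodory_measurable => X /=.
apply: le_ereal_inf_tmp => _ [F XF <-].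
apply/lee_addgt0Pr => e e0.
have e_gt0 k : 0 < e / (2 ^ k.+1)%:R by rewrite divr_gt0// ltr0n expn_gt0.
have [d dP] := choice (fun k =>
  @box_volume_split (F k).1 (F k).2 i c _ (e_gt0 k)).
pose G k := (set_coord (F k).1 i (Num.max ((F k).1 ord0 i) c), (F k).2).
pose H k := ((F k).1, set_coord (F k).2 i (Num.min ((F k).2 ord0 i) (c + d k))).
apply: (@le_trans _ _ (\sum_(k <oo) (box_volume (G k).1 (G k).2)%:E +
                       \sum_(k <oo) (box_volume (H k).1 (H k).2)%:E)%E).
  apply: leeD; apply: ereal_inf_lbound.
  - exists G => // x [/XF[k _ xk] /= cx]; exists k => // j.
    rewrite mxE; have := xk j; case: eqP => // -> /andP[ax ->].
    by rewrite gt_max ax cx.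
  - exists H => // x [/XF[k _ xk] /= /negP cx]; exists k => // j.
    rewrite mxE; have := xk j; case: eqP => // -> /andP[-> xb].
    rewrite lt_min xb/=; rewrite -leNgt in cx; rewrite (le_lt_trans cx)//.
    by rewrite ltrDl; exact: (dP k).1.
rewrite -nneseriesD; try by move=> *; exact: box_volume_ge0.
apply: le_trans (epsilon_trick _ _ (ltW e0)); last first.
  by move=> k; exact: box_volume_ge0.
apply: lee_nneseries => k _; first by rewrite adde_ge0// box_volume_ge0.
by rewrite -!EFinD lee_fin; exact: (dP k).2.
Qed.

Lemma measurable_coord (i : 'I_n.+1) :
  measurable_fun [set: Rn R n] (fun x : Rn R n => x ord0 i).
Proof.
apply: (measurability _ (RGenOInfty.measurableE R)).
move=> _ [_ [c ->] <-]; rewrite setTI.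
rewrite [X in measurable X](_ : _ = [set x : Rn R n | c < x ord0 i]).
  exact: measurable_coord_gt.
by apply/seteqP; split => x /=; rewrite in_itv/= andbT.
Qed.

Lemma measurable_open_box a b : measurable (open_box a b : set (Rn R n)).
Proof.
rewrite [X in measurable X](_ : _ = \bigcap_(i in [set: 'I_n.+1])
    ([set: Rn R n] `&` (fun x : Rn R n => x ord0 i) @^-1` `]a ord0 i, b ord0 i[)).
  apply: fin_bigcap_measurable => // i _.
  by apply: (measurable_coord i) => //; exact: measurable_itv.
apply/seteqP; split => x /=.
  by move=> xab i _ /=; rewrite in_itv/=.
by move=> H i; have /= [_] := H i I; rewrite in_itv.
Qed.

Lemma cube_measure (Q : set (Rn R n)) : is_cube Q ->
  measurable Q /\ (0 < lebesgue R n Q < +oo)%E.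
Proof.
move=> [a [l [l0 ->]]]; split; first exact: measurable_open_box.
rewrite /lebesgue lebesgue_outer_open_box ltry andbT lte_fin.
by apply: prodr_gt0 => i _; rewrite !mxE addrAC subrr add0r lt_max l0 orbT.
Qed.

End boxes.

(** * Elementary inequalities for powers *)

Section powR_lemmas.
Context {R : realType}.
Implicit Types p m t : R.

(** The graph of the convex function [t `^ p] lies above its tangent at [m].
This form, free of derivatives, is Young's inequality for the product of [t] and
[m `^ (p - 1)].  It serves as a substitute for convexity in what follows. *)
Lemma powR_tangent p m t : 1 <= p -> 0 <= m -> 0 <= t ->
  p * m `^ (p - 1) * t <= t `^ p + (p - 1) * m `^ p.
Proof.
move=> p1 m0 t0; have p0 : 0 < p by exact: lt_le_trans p1.
have [->|pn1] := eqVneq p 1.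
  by rewrite subrr powRr0 !mul1r mul0r addr0 powRr1.
have {}p1 : 0 < p - 1 by rewrite subr_gt0 lt_neqAle eq_sym pn1.
have := @conjugate_powR _ t (m `^ (p - 1)) p (p / (p - 1)) t0 (powR_ge0 _ _) p0.
have pq : p^-1 + (p / (p - 1))^-1 = 1.
  by field; rewrite !gt_eqF.
rewrite divr_gt0// => /(_ isT pq).
rewrite -powRrM (_ : (p - 1) * (p / (p - 1)) = p); last by field; rewrite gt_eqF.
rewrite -(ler_pM2l p0) => H; rewrite mulrAC -mulrA (le_trans H)//.
by rewrite le_eqVlt; apply/orP; left; apply/eqP; field; rewrite !gt_eqF.
Qed.

Lemma le_powR1 p t : 1 <= p -> 0 <= t -> t <= t `^ p + 1.
Proof.
move=> p1 t0; have := powR_tangent p1 ler01 t0.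
by rewrite !powR1 /= !mulr1; have := powR_ge0 t p; nra.
Qed.

(** Add the tangent inequalities at the midpoint of the two distances. *)
Lemma powR_dist_triangle p (x y z : R) : 1 <= p ->
  `|x - z| `^ p <= 2 `^ (p - 1) * (`|x - y| `^ p + `|y - z| `^ p).
Proof.
move=> p1; have p0 : 0 < p by exact: lt_le_trans p1.
pose m := (`|x - y| + `|y - z|) / 2.
have m0 : 0 <= m by rewrite mulr_ge0// addr_ge0.
have mm : m `^ (p - 1) * m = m `^ p.
  rewrite -{2}(powRr1 m0) -powRD ?subrK//.
  by rewrite gt_eqF.
have H1 := powR_tangent p1 m0 (normr_ge0 (x - y)).
have H2 := powR_tangent p1 m0 (normr_ge0 (y - z)).
have H : 2 * m `^ p <= `|x - y| `^ p + `|y - z| `^ p.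
  have : p * m `^ (p - 1) * (2 * m) <= `|x - y| `^ p + `|y - z| `^ p +
      2 * ((p - 1) * m `^ p).
    rewrite (_ : 2 * m = `|x - y| + `|y - z|); last by rewrite /m; field.
    lra.
  rewrite (_ : p * _ * _ = 2 * p * m `^ p); last by rewrite -mm; ring.
  lra.
have E2 : 2 `^ p = 2 `^ (p - 1) * 2 :> R.
  by rewrite -{3}(@powRr1 _ 2)// -powRD ?subrK// gt_eqF.
apply: (@le_trans _ _ ((2 * m) `^ p)).
  rewrite ge0_ler_powR ?nnegrE ?(ltW p0)// ?mulr_ge0//.
  rewrite (_ : 2 * m = `|x - y| + `|y - z|); last by rewrite /m; field.
  by rewrite (le_trans _ (ler_normD _ _))// addrA subrK.
by rewrite powRM// E2 -mulrA ler_wpM2l// powR_ge0.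
Qed.

Lemma cvg_powR p (y : R) (u : R^nat) : 0 < y ->
  u @ \oo --> y -> (u k) `^ p @[k --> \oo] --> y `^ p.
Proof.
move=> y0 uy; apply: (@continuous_cvg _ _ _ _ _ _ (fun t : R => t `^ p)) => //.
apply: differentiable_continuous; apply/derivable1_diffP.
by apply: derivable_powR; rewrite ?oner_neq0// in_itv/= y0.
Qed.

End powR_lemmas.

(** * Means and oscillations on a set of finite measure *)

Section measure.
Context d (T : measurableType d) (R : realType).
Variable mu : {measure set T -> \bar R}.
Implicit Types (E : set T) (f g : T -> R) (p : R).

(** The integral of a nonnegative function is the supremum of the integrals of
the simple functions below it, hence monotone in the domain for arbitrary sets,
among them the compact sets over which local integrability is tested. *)
Lemma ge0_subset_integralT (A B : set T) (f : T -> \bar R) :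
  (forall x, 0 <= f x)%E -> A `<=` B ->
  (\int[mu]_(x in A) f x <= \int[mu]_(x in B) f x)%E.
Proof.
move=> f0 AB; rewrite !ge0_integralE//.
apply: ereal_sup_le => _ [h hA <-]; exists h => // x.
apply: (le_trans (hA x)); rewrite /patch; case: ifPn => [xA|_].
  by rewrite mem_set//; apply: AB; rewrite inE in xA.
by case: ifP.
Qed.

Lemma measurable_powR_dist E f (b p : R) : measurable_fun E f ->
  measurable_fun E (fun x => (`|f x - b| `^ p)%:E).
Proof.
move=> mf; apply/measurable_EFinP.
apply: (@measurableT_comp _ _ _ _ _ _ (@powR R ^~ p)) => //.
by apply: measurableT_comp => //; exact: measurable_funB.
Qed.

(** Jensen's inequality for the power [p]: integrate over [E] the tangent
inequality at the absolute value [m] of the mean. *)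
Lemma powR_mean_le E g p : 1 <= p ->
  measurable E -> (0 < mu E < +oo)%E -> mu.-integrable E (EFin \o g) ->
  ((`|(fine (mu E))^-1 * \int[mu]_(x in E) g x| `^ p)%:E * mu E <=
   \int[mu]_(x in E) (`|g x| `^ p)%:E)%E.
Proof.
move=> p1 mE /andP[muE0 muEoo] ig.
set V := fine (mu E).
have VE : mu E = V%:E by rewrite fineK// ge0_fin_numE.
have V0 : 0 < V by rewrite -lte_fin -VE.
set m := `|_|.
have m0 : 0 <= m by exact: normr_ge0.
have mg : measurable_fun E g.
  by apply/measurable_EFinP; exact: measurable_int ig.
have mgp : measurable_fun E (fun x => (`|g x| `^ p)%:E).
  have := measurable_powR_dist 0 p mg.
  by apply: eq_measurable_fun => x _; rewrite subr0.
have mV : ((m * V)%:E <= \int[mu]_(x in E) `|g x|%:E)%E.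
  have := le_abse_integral mu mE (measurable_int _ ig).
  apply: le_trans; rewrite /m normrM ger0_norm ?invr_ge0 ?(ltW V0)//.
  by rewrite mulrAC mulVf ?gt_eqF// mul1r EFin_normr_Rintegral.
have mm : p * m `^ (p - 1) * m = p * m `^ p.
  rewrite -mulrA -{2}(powRr1 m0) -powRD ?subrK//.
  by apply/implyP => /eqP; lra.
have c0 : 0 <= p * m `^ (p - 1).
  by rewrite mulr_ge0 ?powR_ge0// (le_trans _ p1).
have : ((p * m `^ p * V)%:E <=
    \int[mu]_(x in E) (`|g x| `^ p)%:E + ((p - 1) * m `^ p * V)%:E)%E.
  rewrite -mm -mulrA EFinM.
  apply: (@le_trans _ _ ((p * m `^ (p - 1))%:E * \int[mu]_(x in E) `|g x|%:E)%E).
    by rewrite lee_wpmul2l// lee_fin.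
  rewrite -ge0_integralZl_EFin//; last first.
    by apply/measurable_EFinP; exact: measurableT_comp.
  rewrite [X in (_ + X)%E]EFinM -VE -integral_cst// -ge0_integralD//; last first.
  - by move=> x _; rewrite lee_fin mulr_ge0 ?powR_ge0// subr_ge0.
  apply: ge0_le_integral => //.
  - by move=> x _; rewrite mule_ge0// lee_fin.
  - by apply: measurable_funeM; apply/measurable_EFinP; exact: measurableT_comp.
  - exact: emeasurable_funD.
  - by move=> x _; rewrite -EFinM -EFinD lee_fin powR_tangent.
rewrite VE -EFinM; have := @integral_ge0 _ _ _ mu E (fun x => (`|g x| `^ p)%:E).
case: (\int[mu]_(x in E) _)%E => [r _|_|]; rewrite ?leey//.
by rewrite -EFinD !lee_fin; lra.
Qed.

Lemma powR_mean_dist_le E f p (b : R) : 1 <= p ->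
  measurable E -> (0 < mu E < +oo)%E -> mu.-integrable E (EFin \o f) ->
  ((`|(fine (mu E))^-1 * \int[mu]_(x in E) f x - b| `^ p)%:E * mu E <=
   \int[mu]_(x in E) (`|f x - b| `^ p)%:E)%E.
Proof.
move=> p1 mE muE if_; have /andP[muE0 muEoo] := muE.
have V0 : 0 < fine (mu E) by rewrite fine_gt0// muE0.
have ib : mu.-integrable E (EFin \o cst b).
  apply/integrableP; split; first by apply/measurable_EFinP; exact: measurable_cst.
  by rewrite /= integral_cst// lte_mul_pinfty.
have <- : (fine (mu E))^-1 * \int[mu]_(x in E) (f x - b) =
    (fine (mu E))^-1 * \int[mu]_(x in E) f x - b.
  rewrite RintegralB// Rintegral_cst// mulrBr; congr (_ - _).
  by field; rewrite gt_eqF.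
by apply: powR_mean_le => //; exact: (integrableB mE if_ ib).
Qed.

(** The mean is, up to a constant factor, the best constant approximating [f] in
L^p: one compares [f] with [b] and then [b] with the mean, and Jensen's
inequality bounds the second part by the first. *)
Lemma integral_oscillation_le E f p (b : R) : 1 <= p ->
  measurable E -> (0 < mu E < +oo)%E -> mu.-integrable E (EFin \o f) ->
  (\int[mu]_(x in E)
     (`|f x - (fine (mu E))^-1 * \int[mu]_(x in E) f x| `^ p)%:E <=
   (2 `^ p)%:E * \int[mu]_(x in E) (`|f x - b| `^ p)%:E)%E.
Proof.
move=> p1 mE muE if_; have /andP[muE0 muEoo] := muE.
have mf : measurable_fun E f.
  by apply/measurable_EFinP; exact: measurable_int if_.
have := powR_mean_dist_le b p1 mE muE if_; set m := _ * _.
set I := (\int[mu]_(x in E) (`|f x - b| `^ p)%:E)%E => mI.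
have I0 : (0 <= I)%E by apply: integral_ge0 => x _; rewrite lee_fin powR_ge0.
have c0 : 0 <= 2 `^ (p - 1) :> R by exact: powR_ge0.
apply: (@le_trans _ _ ((2 `^ (p - 1))%:E *
   (I + (`|m - b| `^ p)%:E * mu E))%E); last first.
  apply: (@le_trans _ _ ((2 `^ (p - 1))%:E * (I + I))%E).
    by rewrite lee_wpmul2l ?lee_fin// leeD2l.
  have E2 : 2 `^ p = 2 `^ (p - 1) * 2 :> R.
    by rewrite -{3}(@powRr1 _ 2)// -powRD ?subrK// gt_eqF// (lt_le_trans _ p1).
  by rewrite E2 EFinM -muleA -mule2n -mule_natl.
have mfp c := measurable_powR_dist c p mf.
have cst_ge0 x : E x -> (0 <= cst (`|m - b| `^ p)%:E x)%E.
  by rewrite lee_fin powR_ge0.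
have fp_ge0 c x : E x -> (0 <= (`|f x - c| `^ p)%:E)%E.
  by rewrite lee_fin powR_ge0.
rewrite -integral_cst// -ge0_integralD// -ge0_integralZl_EFin//; last 2 first.
- by move=> x Ex; apply: adde_ge0; [exact: fp_ge0|exact: cst_ge0].
- exact: emeasurable_funD.
apply: ge0_le_integral => //.
- by apply: measurable_funeM; apply: emeasurable_funD.
move=> x _; rewrite -EFinD -EFinM lee_fin.
by rewrite (distrC m b) powR_dist_triangle.
Qed.

End measure.

Lemma limn_einf_le (R : realType) (u : (\bar R)^nat) (c : \bar R) :
  (forall k, u k <= c)%E -> (limn_einf u <= c)%E.
Proof.
move=> uc; rewrite limn_einf_lim; apply: lime_le; first exact: is_cvg_einfs.
apply: nearW => k; apply: le_trans (uc k).
by apply: ereal_inf_lbound; exists k => /=.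
Qed.

Lemma limn_einf_ge0 (R : realType) (u : (\bar R)^nat) :
  (forall k, 0 <= u k)%E -> (0 <= limn_einf u)%E.
Proof.
move=> u0; rewrite limn_einf_lim; apply: lime_ge; first exact: is_cvg_einfs.
by apply: nearW => k; apply: le_ereal_inf_tmp => _ [m _ <-].
Qed.

Lemma Lnorm_le_powR d (T : measurableType d) (R : realType)
    (mu : {measure set T -> \bar R}) (g : T -> R) (p K : R) :
  1 <= p -> 0 <= K ->
  ('N[mu]_(p%:E) [EFin \o g] <= K%:E)%E =
  (\int[mu]_x (`|g x| `^ p)%:E <= (K `^ p)%:E)%E.
Proof.
move=> p1 K0; have p0 : 0 < p by exact: lt_le_trans p1.
have <- : ('N[mu]_(p%:E) [EFin \o g] `^ p = \int[mu]_x (`|g x| `^ p)%:E)%E.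
  by rewrite poweR_Lnorm ?gt_eqF.
have := Lnorm_ge0 mu p%:E (EFin \o g).
set N := ('N[mu]_(p%:E) [_])%E => N0.
apply/idP/idP => H.
  rewrite -poweR_EFin gt0_ler_poweR// ?(ltW p0)// in_itv/= leey andbT//.
have /(gt0_ler_poweR (r := p^-1)) : (N `^ p <= K%:E `^ p)%E by rewrite poweR_EFin.
rewrite -!poweRrM mulfV ?gt_eqF// !poweRe1//; apply.
- by rewrite invr_ge0 ltW.
- by rewrite in_itv/= leey andbT poweR_ge0.
- by rewrite in_itv/= leey andbT lee_fin powR_ge0.
Qed.

(** * Cubes *)

Section JN_Lp.
Context {R : realType} {n : nat}.
Local Notation mu := (lebesgue R n).
Implicit Types (f : Rn R n -> R) (Q : set (Rn R n)) (p K b : R).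

Lemma is_cube_sub_compact Q : is_cube Q ->
  exists2 K : set 'rV[R]_n.+1, compact K & Q `<=` K.
Proof.
move=> [a [l [l0 ->]]].
pose A (i : 'I_n.+1) := `[a ord0 i, a ord0 i + l]%classic.
exists [set v : 'rV[R]_n.+1 | forall i, A i (v ord0 i)].
  by apply: rV_compact => i; exact: segment_compact.
move=> x xQ i; rewrite /A /= in_itv/=.
by have := xQ i; rewrite !mxE => /andP[/ltW -> /ltW ->].
Qed.

(** The half-side is [k.+1] rather than [k] for the first cube to be nonempty. *)
Definition centered_cube (k : nat) : set (Rn R n) :=
  open_box (const_mx (- k.+1%:R)) (const_mx (- k.+1%:R) + const_mx (2 * k.+1%:R)).

Lemma is_cube_centered k : is_cube (centered_cube k).
Proof.
by exists (const_mx (- k.+1%:R)), (2 * k.+1%:R); split => //; rewrite mulr_gt0.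
Qed.

Lemma centered_cubeP k (x : Rn R n) :
  centered_cube k x <-> forall i, `|x ord0 i| < k.+1%:R.
Proof.
have E : (- k.+1%:R + 2 * k.+1%:R = k.+1%:R :> R) by ring.
by split => H i; have := H i; rewrite !mxE E ltr_norml.
Qed.

Lemma bounded_sub_centered_cube (A : set 'rV[R]_n.+1) :
  bounded_set A -> exists k, A `<=` centered_cube k.
Proof.
move=> [M [Mreal MA]]; exists (Num.truncn (`|M| + 1)) => x Ax.
apply/centered_cubeP => i.
apply: (@le_lt_trans _ _ `|x|).
  rewrite [leRHS]/Num.norm /= mx_normrE.
  by apply/bigmax_geP; right; exists (ord0, i).
apply: (@le_lt_trans _ _ (`|M| + 1)); last exact: truncnS_gt.
by apply: MA => //; rewrite ltr_pwDr// ler_norm.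
Qed.

Lemma centered_cube_mono k m : (k <= m)%N -> centered_cube k `<=` centered_cube m.
Proof.
move=> km x /centered_cubeP xk; apply/centered_cubeP => i.
by rewrite (lt_le_trans (xk i))// ler_nat ltnS.
Qed.

Lemma centered_cube_cover (x : Rn R n) : exists k, centered_cube k x.
Proof.
have [|k] := @bounded_sub_centered_cube [set x : 'rV[R]_n.+1].
  exists `|x : 'rV[R]_n.+1|; split; first exact: num_real.
  by move=> M xM y /= ->; exact: ltW.
by exists k; apply: p.
Qed.

Lemma integrable_cube f Q : locally_integrableRn f -> is_cube Q ->
  mu.-integrable Q (EFin \o f).
Proof.
move=> [mf intf] cQ; have [mQ _] := cube_measure cQ.
have [K cK QK] := is_cube_sub_compact cQ.
apply/integrableP; split.
  by apply/measurable_EFinP; exact: measurable_funTS.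
by apply: le_lt_trans (intf K cK); exact: ge0_subset_integralT.
Qed.

(** * The John-Nirenberg bound and L^p norms *)

Lemma measure_mean_oscillation p f Q : 1 <= p -> is_cube Q ->
  (mu Q * mean_oscillation p f Q `^ (p / p) =
   \int[mu]_(x in Q) (`|f x - average f Q| `^ p)%:E)%E.
Proof.
move=> p1 /cube_measure[_ /andP[Q0 Qoo]].
have I0 : (0 <= \int[mu]_(x in Q) (`|f x - average f Q| `^ p)%:E)%E.
  by apply: integral_ge0 => x _; rewrite lee_fin powR_ge0.
have VE : mu Q = (fine (mu Q))%:E by rewrite fineK// ge0_fin_numE// ltW.
have V0 : 0 < fine (mu Q) by rewrite -lte_fin -VE.
rewrite divff ?gt_eqF ?(lt_le_trans _ p1)// poweRe1; last first.
  by rewrite mule_ge0// lee_fin invr_ge0 ltW.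
by rewrite muleA [X in (X * _ * _)%E]VE -EFinM mulfV ?gt_eqF// mul1e.
Qed.

(** The bound speaks of infinite sequences of disjoint cubes, so [Q] is completed
to such a sequence by its translates along the diagonal. *)
Lemma JN_bound_oscillation p f K Q : 1 <= p -> JN_bound p p f K -> is_cube Q ->
  (\int[mu]_(x in Q) (`|f x - average f Q| `^ p)%:E <= (K `^ p)%:E)%E.
Proof.
move=> p1 fK [a [l [l0 QE]]].
pose S (i : nat) : set (Rn R n) :=
  open_box (a + const_mx (l *+ i)) (a + const_mx (l *+ i) + const_mx l).
have cS i : is_cube (S i) by exists (a + const_mx (l *+ i)), l.
have tS : trivIset [set: nat] S.
  apply/trivIsetP => i j _ _; wlog ij : i j / (i < j)%N.
    move=> H ij; have := ij; rewrite neq_lt => /orP[|] lt; first exact: H.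
    by rewrite setIC; apply: H => //; rewrite eq_sym.
  move=> _; rewrite -subset0 => x [/(_ ord0) xi /(_ ord0)].
  move: xi; rewrite !mxE => /andP[_ xi] /andP[xj _].
  have : l *+ i + l <= l *+ j by rewrite -mulrSr ler_wpMn2l// ltW.
  lra.
apply: le_trans (fK S cS tS).
have S0 : S 0%N = Q.
  by rewrite /S mulr0n (_ : const_mx 0 = 0) ?addr0//; apply/matrixP => i j; rewrite !mxE.
rewrite (nneseriesD1 (n := 0%N))//; last first.
  by move=> k _; rewrite mule_ge0// poweR_ge0.
rewrite S0 measure_mean_oscillation//; last by rewrite -S0.
by rewrite leeDl//; apply: nneseries_ge0 => k _ _; rewrite mule_ge0// poweR_ge0.
Qed.

Lemma JN_bound_of_Lp p f b K : 1 <= p -> 0 <= K -> locally_integrableRn f ->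
  (\int[mu]_x (`|f x - b| `^ p)%:E <= (K `^ p)%:E)%E ->
  JN_bound p p f (2 * K).
Proof.
move=> p1 K0 lf fK Q cQ tQ.
have mQ i : measurable (Q i) := (cube_measure (cQ i)).1.
have mfb : measurable_fun setT (fun x => (`|f x - b| `^ p)%:E).
  by apply: measurable_powR_dist; exact: lf.1.
have fb0 x : (0 <= (`|f x - b| `^ p)%:E)%E by rewrite lee_fin powR_ge0.
apply: (@le_trans _ _ (\sum_(i <oo) (2 `^ p)%:E *
    \int[mu]_(x in Q i) (`|f x - b| `^ p)%:E)%E).
  apply: lee_nneseries => i _; first by rewrite mule_ge0// poweR_ge0.
  rewrite measure_mean_oscillation//; apply: integral_oscillation_le => //.
  - exact: (cube_measure (cQ i)).2.
  - exact: integrable_cube.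
rewrite nneseriesZl//; last by move=> i _; exact: integral_ge0.
rewrite powRM// EFinM lee_wpmul2l// ?lee_fin ?powR_ge0//.
apply: le_trans fK; rewrite -ge0_integral_bigcup//.
  exact: ge0_subset_integralT.
exact: measurable_funTS.
Qed.

(** Jensen's inequality on the smaller cube, the oscillation being bounded on
the larger one. *)
Lemma JN_bound_average_dist p f K (Q Q' : set (Rn R n)) : 1 <= p ->
  locally_integrableRn f -> JN_bound p p f K -> is_cube Q -> is_cube Q' ->
  Q `<=` Q' ->
  `|average f Q - average f Q'| `^ p <= K `^ p / fine (mu Q).
Proof.
move=> p1 lf fK cQ cQ' QQ'.
have [mQ muQ] := cube_measure cQ.
have V0 : 0 < fine (mu Q) by rewrite fine_gt0.
rewrite ler_pdivlMr// -lee_fin EFinM fineK; last first.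
  by case/andP: muQ => /ltW muQ0 muQoo; rewrite ge0_fin_numE.
have mean_dist := powR_mean_dist_le (average f Q') p1 mQ muQ (integrable_cube lf cQ).
apply: (le_trans mean_dist); apply: le_trans (JN_bound_oscillation p1 fK cQ').
by apply: ge0_subset_integralT => // x; rewrite lee_fin powR_ge0.
Qed.

(** The constant [b] is a limit point of the averages over the centered cubes,
and the inequality survives the passage to the limit by Fatou's lemma. *)
Lemma JN_bound_Lp p f K : 1 <= p -> 0 <= K -> locally_integrableRn f ->
  JN_bound p p f K ->
  exists b, (\int[mu]_x (`|f x - b| `^ p)%:E <= (K `^ p)%:E)%E.
Proof.
move=> p1 K0 lf fK; have p0 : 0 < p by exact: lt_le_trans p1.
pose C := centered_cube; have cC := is_cube_centered.
pose c k := average f (C k).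
have [s s_incr /cvg_ex[b cb]] :
    exists2 s : nat -> nat, increasing_seq s & cvgn (c \o s).
  apply: bolzano_weierstrass.
  exists (`|c 0%N| + (K `^ p / fine (mu (C 0%N)) + 1)); split.
    exact: num_real.
  move=> M cM k _ /=; apply: le_trans (ltW cM).
  have C0k : C 0%N `<=` C k by exact: centered_cube_mono.
  have dist0 := JN_bound_average_dist p1 lf fK (cC 0%N) (cC k) C0k.
  rewrite -[c k](subrK (c 0%N)) addrC (le_trans (ler_normD _ _))// lerD2l.
  by rewrite distrC (le_trans (le_powR1 p1 _))// lerD2r.
exists b.
have mdist t := measurable_powR_dist t p lf.1.
have dist_ge0 t x : (0 <= (`|f x - t| `^ p)%:E)%E by rewrite lee_fin powR_ge0.
have mC k : measurable (C k) by exact: (cube_measure (cC k)).1.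
pose F k : Rn R n -> \bar R :=
  (fun x => (`|f x - c (s k)| `^ p)%:E) \_ (C (s k)).
have F_ge0 k x : (0 <= F k x)%E by rewrite /F patchE; case: ifP.
have mF k : measurable_fun setT (F k).
  apply/(measurable_restrictT _ _).1 => //; exact: measurable_funTS.
apply: (@le_trans _ _ (\int[mu]_x limn_einf (F^~ x))%E); last first.
  apply: le_trans (fatou _ _ _ _) _ => //.
  apply: limn_einf_le => k; rewrite /F -integral_mkcond.
  exact: JN_bound_oscillation.
have F_lim x : ((`|f x - b| `^ p)%:E <= limn_einf (F^~ x))%E.
  (* t `^ p is continuous at t > 0; at t = 0 the inequality is trivial *)
  have [fxb|fxb] := eqVneq (f x) b.
    by rewrite fxb subrr normr0 powR0 ?gt_eqF//; exact: limn_einf_ge0.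
  have fxb0 : 0 < `|f x - b| by rewrite normr_gt0 subr_eq0.
  suff Fx : F k x @[k --> \oo] --> (`|f x - b| `^ p)%:E.
    rewrite is_cvg_limn_einfE; last by apply/cvg_ex; eexists; exact: Fx.
    by rewrite (cvg_lim _ Fx).
  have [k0 xk0] := centered_cube_cover x.
  have Fx : \forall k \near \oo, (`|f x - c (s k)| `^ p)%:E = F k x.
    near=> k; rewrite /F patchE mem_set//.
    have sk : (k <= s k)%N.
      elim: (k) => // j IH; rewrite (leq_ltn_trans IH)//.
      by rewrite ltnNge -leEnat s_incr ltnn.
    apply: centered_cube_mono xk0; apply: leq_trans sk.
    by near: k; exact: nbhs_infty_ge.
  apply: cvg_trans (near_eq_cvg Fx) _.
  apply: cvg_EFin; first exact: nearW.
  apply: cvg_powR fxb0 _; apply: cvg_norm; apply: cvgB cb; exact: cvg_cst.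
apply: ge0_le_integral.
- exact: measurableT.
- by move=> x _; exact: dist_ge0.
- exact: mdist.
- apply: (@measurableT_comp _ _ _ _ _ _ -%E); first exact: oppe_measurable.
  apply: measurable_fun_limn_esup => k.
  by apply: measurableT_comp (mF k); exact: oppe_measurable.
- by move=> x _; exact: F_lim.
Unshelve. all: by end_near. Qed.

(** On a cube, [`|f|] is at most [`|f - b| `^ p + 1 + `|b|], and constants are
integrable there. *)
Lemma Lp_locally_integrable p f b : 1 <= p ->
  measurable_fun setT f -> (\int[mu]_x (`|f x - b| `^ p)%:E < +oo)%E ->
  locally_integrableRn f.
Proof.
move=> p1 mf fpoo; split => // K /compact_bounded/bounded_sub_centered_cube[k Kk].
have [mC /andP[_ Coo]] := cube_measure (is_cube_centered k).
have mfp := measurable_powR_dist b p (measurable_funTS (D := centered_cube k) mf).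
have fp0 x : (0 <= (`|f x - b| `^ p)%:E)%E by rewrite lee_fin powR_ge0.
have c0 : 0 <= 1 + `|b| by rewrite addr_ge0.
apply: (@le_lt_trans _ _ (\int[mu]_(x in centered_cube k)
    ((`|f x - b| `^ p)%:E + (1 + `|b|)%:E))%E); last first.
  rewrite ge0_integralD// integral_cst// lte_add_pinfty ?lte_mul_pinfty//.
  by apply: le_lt_trans fpoo; exact: ge0_subset_integralT.
apply: (@le_trans _ _ (\int[mu]_(x in centered_cube k) `|f x|%:E)%E).
  by apply: ge0_subset_integralT.
apply: ge0_le_integral; first exact: mC.
- by move=> x _; rewrite lee_fin.
- by apply/measurable_EFinP; apply: measurableT_comp => //; exact: measurable_funTS.
- exact: emeasurable_funD.
move=> x _; rewrite -EFinD lee_fin addrA -{1}(subrK b (f x)).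
by rewrite (le_trans (ler_normD _ _))// lerD2r le_powR1.
Qed.

Lemma JN_norm_le p f b : 1 <= p -> locally_integrableRn f ->
  (JN_norm p p f <= 2%:E * 'N[mu]_(p%:E) [EFin \o (fun x => f x - b)%R])%E.
Proof.
move=> p1 lf; have := Lnorm_ge0 mu p%:E (EFin \o (fun x => f x - b)).
have := Lnorm_le_powR mu (fun x => f x - b) p1.
case: ('N[mu]_(p%:E) [_])%E => [K fK K0|_ _|//]; last first.
  by rewrite gt0_muley ?leey.
rewrite lee_fin in K0; apply: ereal_inf_lbound; exists (2 * K) => //.
split; first by rewrite mulr_ge0.
by apply: (JN_bound_of_Lp (b := b)) => //; rewrite -fK.
Qed.

Lemma Lp_dist_le_JN_norm p f : 1 <= p -> locally_integrableRn f ->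
  (ereal_inf (range (fun b : R =>
     'N[mu]_(p%:E) [EFin \o (fun x => f x - b)%R])) <= JN_norm p p f)%E.
Proof.
move=> p1 lf; apply: le_ereal_inf_tmp => _ [K [K0 fK] <-].
have [b fb] := JN_bound_Lp p1 K0 lf fK.
apply: (@le_trans _ _ ('N[mu]_(p%:E) [EFin \o (fun x => f x - b)%R])%E).
  by apply: ereal_inf_lbound; exists b.
by rewrite Lnorm_le_powR.
Qed.

Lemma JN_norm_ge0 p f : (0 <= JN_norm p p f)%E.
Proof. by apply: le_ereal_inf_tmp => _ [K [K0 _] <-]; rewrite lee_fin. Qed.

Lemma JN_eq_Lp_mod_cst p : 1 <= p -> JN R n p p = Lp_mod_cst R n p.
Proof.
move=> p1; apply/seteqP; split => [f [lf [K K0 fK]]|f [b]].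
  have [b fb] := JN_bound_Lp p1 K0 lf fK; exists b.
  rewrite inE; apply/andP; split; rewrite inE/=.
    by apply: measurable_funB => //; exact: lf.1.
  by rewrite /finite_norm (le_lt_trans _ (ltry K))// Lnorm_le_powR.
rewrite inE => /andP[]; rewrite !inE /= /finite_norm => mfb.
have mf : measurable_fun setT f.
  have := measurable_funD mfb (measurable_cst b).
  by apply: eq_measurable_fun => x _ /=; rewrite subrK.
have := Lnorm_ge0 mu p%:E (EFin \o (fun x => f x - b)).
have := Lnorm_le_powR mu (fun x => f x - b) p1.
case: ('N[mu]_(p%:E) [_])%E => [K fK K0 _|//|//].
rewrite lee_fin in K0; have fbK := fK _ K0; rewrite lexx in fbK.
have lf : locally_integrableRn f.
  apply: (Lp_locally_integrable (b := b) p1 mf).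
  by rewrite (@le_lt_trans _ _ (K `^ p)%:E) ?ltry// -fbK.
split => //; exists (2 * K); first by rewrite mulr_ge0.
by apply: (JN_bound_of_Lp (b := b)) => //; rewrite -fbK.
Qed.

End JN_Lp.

Theorem proposition2p7 (R : realType) (p : R) (p1 : 1 <= p) :
  (forall n : nat, JN R n p p = Lp_mod_cst R n p) /\
  exists2 c : R, 0 < c &
    forall (n : nat) (f : Rn R n -> R), locally_integrableRn f ->
      let infLp := ereal_inf
        (range (fun b : R =>
           ('N[lebesgue R n]_(p%:E) [EFin \o (fun x => f x - b)%R])%E)) in
      (c^-1%:E * JN_norm p p f <= infLp)%E /\
      (infLp <= c%:E * JN_norm p p f)%E.
Proof.
split=> [n|]; first exact: JN_eq_Lp_mod_cst.
exists 2 => // n f lf infLp; split.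
  apply: le_ereal_inf_tmp => _ [b _ <-].
  by rewrite lee_pdivrMl// JN_norm_le.
apply: (le_trans (Lp_dist_le_JN_norm p1 lf)).
by rewrite -{1}[leLHS]mul1e lee_wpmul2r ?JN_norm_ge0// lee_fin ler1n.
Qed.
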